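(* Let $\mathbb{F}$ be a finite field of odd characteristic, $k/\mathbb{F}(x)$ an imaginary extension, $\mathcal{O}$ the ring of elements of $k$ regular away from the prime $\infty_k$ above $\infty=\langle1/x\rangle$, and $K/k$ a geometric imaginary quadratic extension whose ring $\mathcal{O}_K$ of elements regular away from the prime $\infty_K$ above $\infty_k$ is $\mathcal{O}_K=\mathcal{O}\oplus\sqrt{\alpha}\,\mathcal{O}$ with $\alpha\in\mathcal{O}$. Let $q=(1,0,-\alpha)$ be its norm form. Then for any $[q']\in\mathfrak{cl}_0(\mathrm{disc}(q))$, $$[q'\star q']\in\mathrm{Cl}_\infty(q):=\mathrm{Cl}_\infty(\underline{\mathrm{SO}}_q).$$
   Context: $k$ is the function field of a projective, smooth, geometrically connected $\mathbb{F}$-curve; it is imaginary if $\infty=\langle1/x\rangle$ of $\mathbb{F}(x)$ does not split into distinct places in $k$. $\mathcal{O}=\{f\in k:v_{\mathfrak p}(f)\ge0\ \forall\mathfrak p\ne\infty_k\}$. For a prime $\mathfrak p$ of $k$, $\hat k_{\mathfrak p}$ is the completion and $\hat{\mathcal O}_{\mathfrak p}$ its ring of integers. A binary quadratic $\mathcal{O}$-form $q$, with $q(Xe_1+Ye_2)=aX^2+bXY+cY^2$, is denoted $(a,b,c)$; it is primitive if its values generate $\mathcal{O}$; $B_q(x,y)=q(x+y)-q(x)-q(y)$ and $\mathrm{disc}(q)=\det(B_q(e_i,e_j))(\mathcal{O}^\times)^2\in\mathcal{O}/(\mathcal{O}^\times)^2$. $\mathfrak{cl}_0(\Delta)$ is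 the set of primitive binary quadratic $\mathcal{O}$-forms of discriminant $\Delta$ modulo $\mathrm{SL}_2(\mathcal{O})$. $\underline{\mathrm{SO}}_q$ is the kernel of $\det$ on the orthogonal $\mathcal{O}$-group scheme $\underline{\mathrm{O}}_q$ of self-isometries of $q$; it is commutative. The map $[\mathrm{Iso}(q,q')]\mapsto[q']$ is a bijection $H^1_{\text{ét}}(\mathcal{O},\underline{\mathrm{SO}}_q)\to\mathfrak{cl}_0(\mathrm{disc}(q))$, through which $\mathfrak{cl}_0(\mathrm{disc}(q))$ inherits an abelian group structure whose operation is denoted $\star$. For an affine $\mathcal{O}$-group scheme $\underline{G}$ with generic fiber $G$, the class set is $\mathrm{Cl}_\infty(\underline{G})=\underline{G}(\mathbb{A}_\infty)\backslash\underline{G}(\mathbb{A})/G(k)$, where $\underline{G}(\mathbb{A})$ is the adelic group and $\underline{G}(\mathbb{A}_\infty)=G(\hat k_{\infty_k})\times\prod_{\mathfrak p\ne\infty_k}\underline{G}(\hat{\mathcal O}_{\mathfrak p})$. For $\underline G$ smooth of finite type it is identified with the principal genus, i.e. the fiber over the trivial class of $H^1_{\text{ét}}(\mathcal{O},\underline{G})\to H^1(k,G)\times\prod_{\mathfrak p\ne\infty_k}H^1_{\text{ét}}(\hat{\mathcal O}_{\mathfrak p},\underline{G}_{\mathfrak p})$. Thus $\mathrm{Cl}_\infty(q)$ is regarded as the subset of $\mathfrak{cl}_0(\mathrm{disc}(q))$ of classes of $\mathcal{O}$-forms that are properly isomorphic to $q$ over $k$ and over $\hat{\mathcal O}_{\mathfrak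 p}$ for every prime $\mathfrak p$ of $\mathcal O$.
   Formalization: Forms in cl_0(disc(q)) have discriminant exactly equal to that of q, not just modulo squares of units: for (1,0,-u²α) with u in F^×, u²≠1, Iso(q,q') is no SO_q-torsor, so the bijection with H^1 fails and q'⋆q' is undefined. *)

(* Defs.v *)
(* MathComp with the classical sets of MathComp-Analysis. *)
From HB Require Import structures.
From mathcomp Require Import all_boot all_order all_algebra all_field.
From mathcomp Require Import boolp classical_sets.

Set Implicit Arguments.
Unset Strict Implicit.
Unset Printing Implicit Defensive.

Import Order.TTheory GRing.Theory Num.Theory.
Local Open Scope ring_scope.
Local Open Scope classical_set_scope.

(* A place is a normalised discrete valuation.  The value at 0, which should
   be +oo, is replaced by the dummy 0; val_ge below restores the convention.
   Over a function field with finite constant field F, places are trivial on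
   F: nonzero constants have finite multiplicative order. *)
Record place (k : fieldType) := Place {
  place_val :> k -> int;
  place0 : place_val 0 = 0;
  placeM : forall x y, x != 0 -> y != 0 ->
    place_val (x * y) = place_val x + place_val y;
  placeD : forall x y, x != 0 -> y != 0 -> x + y != 0 ->
    Num.min (place_val x) (place_val y) <= place_val (x + y);
  place_surj : exists2 x, x != 0 & place_val x = 1
}.

Section Places.
Variable k : fieldType.
Implicit Types (v : place k) (n : int).

Definition val_ge v n : {pred k} := [pred x | (x == 0) || (n <= v x)].

Definition val_int v : {pred k} := val_ge v 0.

Definition regular_away v : {pred k} :=
  [pred x | `[< forall w : place k, w <> v -> x \in val_int w >]].

Lemma place1 v : v 1 = 0.
Proof.
have /(congr1 (fun z => z - v 1)) := @placeM _ v 1 1 (oner_neq0 _) (oner_neq0 _).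
by rewrite mulr1 addrK subrr => <-.
Qed.

Lemma placeN1 v : v (-1) = 0.
Proof.
have h : (-1 : k) != 0 by rewrite oppr_eq0 oner_neq0.
have := @placeM _ v _ _ h h; rewrite mulrNN mulr1 place1 => /esym/eqP.
by rewrite -mulr2n mulrn_eq0 => /eqP.
Qed.

Lemma val_int_closed v : subring_closed (val_int v).
Proof.
split=> [|x y|x y]; rewrite !inE.
- by rewrite place1 lexx orbT.
- have [->|x0] := eqVneq x 0; have [->|y0] := eqVneq y 0.
  + by rewrite subrr eqxx.
  + move=> _ /= hy; have N0 : (-1 : k) != 0 by rewrite oppr_eq0 oner_neq0.
    by rewrite sub0r -mulN1r placeM // placeN1 add0r hy orbT.
  + by rewrite subr0 (negbTE x0).
  + move=> /= hx hy; have [//|d0] := eqVneq (x - y) 0.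
    have N0 : (-1 : k) != 0 by rewrite oppr_eq0 oner_neq0.
    have ny0 : - y != 0 by rewrite oppr_eq0.
    apply: le_trans (placeD v x0 ny0 d0); rewrite le_min hx /=.
    by rewrite -mulN1r placeM // placeN1 add0r.
- have [->|x0] := eqVneq x 0; first by rewrite mul0r eqxx.
  have [->|y0] := eqVneq y 0; first by rewrite mulr0 eqxx.
  by move=> /= hx hy; rewrite placeM // addr_ge0 ?orbT.
Qed.

Lemma regular_away_closed v : subring_closed (regular_away v).
Proof.
split=> [|x y /asboolP hx /asboolP hy|x y /asboolP hx /asboolP hy];
  apply/asboolP => w hw; have [h1 hB hM] := val_int_closed w.
- exact: h1.
- exact: hB (hx w hw) (hy w hw).
- exact: hM (hx w hw) (hy w hw).
Qed.

HB.instance Definition _ v :=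
  GRing.isSubringClosed.Build k (regular_away v) (regular_away_closed v).

Record away_ring v := AwayRing {
  away_val :> k;
  away_valP : away_val \in regular_away v
}.

HB.instance Definition _ v := [isSub for @away_val v].
HB.instance Definition _ v := [Choice of away_ring v by <:].
HB.instance Definition _ v := [SubChoice_isSubComNzRing of away_ring v by <:].

End Places.

(* The prime w of L lies above the prime v of k: the maximal ideal of v is
   contained in that of w. *)
Definition lies_over (k L : fieldType) (i : k -> L) (w : place L) (v : place k)
  : Prop := forall x, 0 < v x -> 0 < w (i x).

Section FunctionField.
Variables (F : fieldType) (k : fieldExtType {fraction {poly F}}).

(* The element c of F(x), viewed in k; with c = 'X this is x itself. *)
Definition of_poly (c : {poly F}) : k := (tofrac c)%:A.

Definition const_in (c : F) : k := of_poly c%:P.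

(* w divides the prime of F(x) generated by 1/x. *)
Definition over_infty (w : place k) : Prop := 0 < w (of_poly 'X)^-1.

End FunctionField.

(* F is algebraically closed in E.  As F is perfect, this says that the smooth
   projective curve with function field E is geometrically connected. *)
Definition full_constant_field (F E : fieldType) (i : F -> E) : Prop :=
  forall z : E, algebraicOver i z -> exists c, z = i c.

(* (L, w) is the completion of k at v, along i. *)
Record is_completion (k L : fieldType) (v : place k) (w : place L)
    (i : {rmorphism k -> L}) : Prop := IsCompletion {
  completion_ext : forall x, w (i x) = v x;
  completion_dense : forall (y : L) (n : int), exists x, y - i x \in val_ge w n;
  completion_complete : forall u : nat -> L,
    (forall n : int, exists N : nat, forall a b : nat,
       (N <= a)%N -> (N <= b)%N -> u a - u b \in val_ge w n) ->
    exists l : L, forall n : int, exists N : nat, forall a : nat,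
       (N <= a)%N -> u a - l \in val_ge w n
}.

(* Bqf a b c is the form aX^2 + bXY + cY^2. *)
Record bqf (R : Type) := Bqf { bqf_a : R; bqf_b : R; bqf_c : R }.

Definition bqf_map (R S : Type) (f : R -> S) (q : bqf R) : bqf S :=
  Bqf (f (bqf_a q)) (f (bqf_b q)) (f (bqf_c q)).

Section Forms.
Variable R : comPzRingType.
Implicit Types (q : bqf R) (u v : 'cV[R]_2).

Definition bqf_eval q v : R :=
  bqf_a q * v 0 0 ^+ 2 + bqf_b q * (v 0 0 * v 1 0) + bqf_c q * v 1 0 ^+ 2.

Definition polar q u v : R :=
  bqf_eval q (u + v) - bqf_eval q u - bqf_eval q v.

(* The determinant itself, not its class modulo squares of units: SL_2
   preserves it, and proper isometry of q and q' forces it to be equal. *)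
Definition disc q : R :=
  \det (\matrix_(i < 2, j < 2) polar q (delta_mx i 0) (delta_mx j 0)).

(* The values of q generate the unit ideal. *)
Definition primitive q : Prop :=
  exists (n : nat) (r : 'I_n -> R) (v : 'I_n -> 'cV[R]_2),
    \sum_i r i * bqf_eval q (v i) = 1.

(* The R-points of Iso(q, q'): proper isometries from q to q'.  For q' = q
   these are the R-points of SO_q. *)
Definition iso_pts q q' : set 'M[R]_2 :=
  [set M | \det M = 1 /\ forall v, bqf_eval q' (M *m v) = bqf_eval q v].

Definition sl2_class q : set (bqf R) := [set q' | iso_pts q q' !=set0].

Definition cl0 (D : R) : set (set (bqf R)) :=
  [set c | exists q, [/\ primitive q, disc q = D & c = sl2_class q]].

End Forms.

Section Star.
Variable A : comNzRingType.
Implicit Types q : bqf A.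

(* Iso(q, q1), Iso(q, q2), Iso(q, q3) are right SO_q-torsors under
   composition.  The sum of the classes of the first two in H^1(A, SO_q) is
   the class of their contracted product over SO_q (which is commutative).
   By the universal property of the contracted product, and since any
   equivariant map between torsors is an isomorphism, the third torsor
   represents this sum iff there is a morphism of A-schemes
     phi : Iso(q, q1) x Iso(q, q2) -> Iso(q, q3)
   with phi (x g, y) = phi (x, y) g = phi (x, y g) for g in SO_q.  The schemes
   being affine, phi is given as a natural transformation of functors on
   A-algebras (R, f); its values outside of the Iso sets are irrelevant. *)
Definition torsor_sum q q1 q2 q3 : Prop :=
  exists phi : forall R : comPzRingType, {rmorphism A -> R} ->
      'M[R]_2 -> 'M[R]_2 -> 'M[R]_2,
  [/\ forall (R : comPzRingType) (f : {rmorphism A -> R}) (x y : 'M[R]_2),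
        iso_pts (bqf_map f q) (bqf_map f q1) x ->
        iso_pts (bqf_map f q) (bqf_map f q2) y ->
        iso_pts (bqf_map f q) (bqf_map f q3) (phi R f x y),
      forall (R S : comPzRingType) (f : {rmorphism A -> R})
          (h : {rmorphism A -> S}) (g : {rmorphism R -> S}) (x y : 'M[R]_2),
        (forall a, g (f a) = h a) ->
        iso_pts (bqf_map f q) (bqf_map f q1) x ->
        iso_pts (bqf_map f q) (bqf_map f q2) y ->
        phi S h (map_mx g x) (map_mx g y) = map_mx g (phi R f x y)
    & forall (R : comPzRingType) (f : {rmorphism A -> R}) (x y g : 'M[R]_2),
        iso_pts (bqf_map f q) (bqf_map f q1) x ->
        iso_pts (bqf_map f q) (bqf_map f q2) y ->
        iso_pts (bqf_map f q) (bqf_map f q) g ->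
        phi R f (x *m g) y = phi R f x y *m g /\
        phi R f x (y *m g) = phi R f x y *m g].

(* The product of two classes of cl0 (disc q), as a set of forms: all forms
   whose class corresponds to the sum in H^1(A, SO_q).  That it is a single
   element of cl0 (disc q) is not built in. *)
Definition star q (c1 c2 : set (bqf A)) : set (bqf A) :=
  [set q3 | [/\ primitive q3, disc q3 = disc q &
     exists q1 q2, [/\ c1 q1, c2 q2 & torsor_sum q q1 q2 q3]]].

End Star.

Section ClassSet.
Variables (k : fieldType) (oo : place k).
Implicit Types q : bqf (away_ring oo).

Definition iso_over_field q q' : Prop :=
  iso_pts (bqf_map val q : bqf k) (bqf_map val q' : bqf k) !=set0.

(* Proper isometry over the ring of integers of the completion at v; the
   completion being unique up to isomorphism, we range over its models. *)
Definition iso_over_completion (v : place k) q q' : Prop :=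
  forall (L : fieldType) (w : place L) (i : {rmorphism k -> L}),
    is_completion v w i ->
    exists2 M : 'M[L]_2, M \is a mxOver (val_int w) &
      iso_pts (bqf_map (fun a => i (val a)) q)
              (bqf_map (fun a => i (val a)) q') M.

(* Cl_infty (SO_q), as the principal genus inside cl0 (disc q). *)
Definition Cl_infty q : set (set (bqf (away_ring oo))) :=
  [set c | exists q', [/\ cl0 (disc q) c, c = sl2_class q',
     iso_over_field q q' &
     forall v : place k, v <> oo -> iso_over_completion v q q']].

End ClassSet.

(* Main.v *)
Require Import Defs.
From HB Require Import structures.
From mathcomp Require Import all_boot all_order all_algebra all_field.
From mathcomp Require Import boolp classical_sets.
From mathcomp Require Import ring.

Set Implicit Arguments.
Unset Strict Implicit.
Unset Printing Implicit Defensive.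

Import Order.TTheory GRing.Theory Num.Theory.
Local Open Scope ring_scope.
Local Open Scope classical_set_scope.

(** The square of a class is locally trivial because a form multiplies with
itself by squaring values: if q' takes the unit value n at w, then q' * q'
takes the value n^2 at the square of w, hence the value 1 at w^2 / n, and a
form of the discriminant of q representing 1 is properly isometric to q.  A
primitive form takes a unit value over every local ring of O and over k, so
q' * q' lies in the principal genus.  The isometries are found over k and over
the valuation rings of k, and extended to the completions.

To make q' * q' explicit, q' is put in the shape (a, 2b, ac) with (a, b)
comaximal, where Gauss composition gives q' * q' = (a^2, 2b, c)
([united_representative], [double_torsor_sum]).  This is Dirichlet's method of
united forms.  Its arithmetic input is that every nonzero quotient of O is
zero-dimensional, i.e. strongly pi-regular ([away_pi_regular]); it is obtained
from the algebraicity of O over F[x].  In such a quotient, if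
x^i (1 - x u) = 0 then 1 - x u is invertible exactly where x is not; this
replaces the choice of residues by the Chinese remainder theorem over the
primes dividing alpha ([coprime_value]).

That [star] is a single class amounts to uniqueness of the contracted product:
two equivariant maps from the same pair of torsors, into Iso(q, q3) and
Iso(q, q4), differ by a matrix that does not depend on the points at which it
is computed ([ratio_indep]).  Points exist after adjoining the square root of a
unit value, and independence makes the matrix invariant under conjugation, so
it descends ([ratio_descent]).  Done over k and over the valuation ring of
every v <> oo, which give the same matrix, this yields an isometry q3 -> q4
with entries in O ([torsor_sum_unique]). *)

(** * Matrices of size two and proper isometries *)

Section TwoByTwo.
Variable R : comPzRingType.
Implicit Types (x y a b c d : R) (M N : 'M[R]_2).

Definition col2 x y : 'cV[R]_2 := \col_i (if i == 0 then x else y).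

Definition mx2 a b c d : 'M[R]_2 :=
  \matrix_(i, j) if i == 0 then (if j == 0 then a else b)
                 else (if j == 0 then c else d).

Lemma ord2P (P : 'I_2 -> Prop) : P 0 -> P 1 -> forall i, P i.
Proof.
move=> P0 P1 [[|[|//]] lt_i2]; first by rewrite (_ : Ordinal _ = 0) //;
  apply: val_inj.
by rewrite (_ : Ordinal _ = 1) //; apply: val_inj.
Qed.

Lemma lift2_0 : lift ord0 ord0 = 1 :> 'I_2. Proof. exact: val_inj. Qed.

Lemma sum2 (F : 'I_2 -> R) : \sum_i F i = F 0 + F 1.
Proof. by rewrite !big_ord_recl big_ord0 addr0 lift2_0. Qed.

Lemma det2 M : \det M = M 0 0 * M 1 1 - M 0 1 * M 1 0.
Proof.
rewrite (expand_det_row M 0) sum2 /cofactor !det_mx11 !mxE /=.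
have -> : lift 0 0 = 1 :> 'I_2 by apply: val_inj.
have -> : lift 1 0 = 0 :> 'I_2 by apply: val_inj.
by rewrite !(addn0, add0n, expr0, expr1) mul1r mulN1r mulrN.
Qed.

Lemma mulmx2 n (M : 'M[R]_2) (N : 'M[R]_(2, n)) i j :
  (M *m N) i j = M i 0 * N 0 j + M i 1 * N 1 j.
Proof. by rewrite mxE sum2. Qed.

Lemma mx2_ext M N : M 0 0 = N 0 0 -> M 0 1 = N 0 1 -> M 1 0 = N 1 0 ->
  M 1 1 = N 1 1 -> M = N.
Proof.
by move=> *; apply/matrixP; elim/ord2P; elim/ord2P.
Qed.

End TwoByTwo.

Section Isometries.
Variable R : comPzRingType.
Implicit Types (q : bqf R) (M N : 'M[R]_2).

(** A quadratic identity in two variables holds on all vectors as soon as it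
holds at e1, e2 and e1 + e2.  The coefficient form of isometries is what
makes them stable under base change, and reflected by injective maps. *)
Lemma iso_ptsP q q' M : iso_pts q q' M <->
  [/\ M 0 0 * M 1 1 - M 0 1 * M 1 0 = 1,
      bqf_a q' * M 0 0 ^+ 2 + bqf_b q' * (M 0 0 * M 1 0)
        + bqf_c q' * M 1 0 ^+ 2 = bqf_a q,
      bqf_a q' * M 0 1 ^+ 2 + bqf_b q' * (M 0 1 * M 1 1)
        + bqf_c q' * M 1 1 ^+ 2 = bqf_c q &
      2%:R * bqf_a q' * (M 0 0 * M 0 1)
        + bqf_b q' * (M 0 0 * M 1 1 + M 0 1 * M 1 0)
        + 2%:R * bqf_c q' * (M 1 0 * M 1 1) = bqf_b q].
Proof.
split=> [[]|[detM aE cE bE]].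
  rewrite det2 => detM eqM.
  have eqc x y := eqM (col2 x y).
  move: (eqc 1 0) (eqc 0 1) (eqc 1 1); rewrite /bqf_eval !mulmx2 !mxE /=.
  rewrite !(mulr0, mulr1, mul0r, mul1r, addr0, add0r, expr0n, expr1n) /=.
  move=> aE cE bE.
  split=> //.
  have -> : bqf_b q = bqf_a q + bqf_b q + bqf_c q - bqf_a q - bqf_c q by ring.
  by rewrite -bE -aE -cE; ring.
split=> [|v]; first by rewrite det2.
by rewrite /bqf_eval !mulmx2 -aE -bE -cE; ring.
Qed.

Lemma iso_ptsM q1 q2 q3 M N :
  iso_pts q1 q2 M -> iso_pts q2 q3 N -> iso_pts q1 q3 (N *m M).
Proof.
move=> [dM eM] [dN eN]; split=> [|v]; first by rewrite det_mulmx dM dN mulr1.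
by rewrite -mulmxA eN eM.
Qed.

Lemma iso_ptsV q q' M : iso_pts q q' M -> iso_pts q' q (\adj M).
Proof.
move=> [dM eM]; have MV : M *m \adj M = 1%:M by rewrite mul_mx_adj dM.
split=> [|v]; last by rewrite -eM mulmxA MV mul1mx.
by rewrite -[LHS]mul1r -dM -det_mulmx MV det1.
Qed.

Lemma iso_pts_adjVK q q' M n (N : 'M[R]_(2, n)) :
  iso_pts q q' M -> M *m (\adj M *m N) = N.
Proof. by case=> dM _; rewrite mulmxA mul_mx_adj dM mul1mx. Qed.

Lemma disc2 q : disc q = 4%:R * bqf_a q * bqf_c q - bqf_b q ^+ 2.
Proof.
rewrite /disc det2 !mxE /polar /bqf_eval !mxE /=.
rewrite -![(true : nat)%:R]/(1%:R) -![(false : nat)%:R]/(0%:R) /=; ring.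
Qed.

Lemma iso_disc q q' : iso_pts q q' !=set0 -> disc q = disc q'.
Proof.
move=> [M /iso_ptsP[dM aE cE bE]]; rewrite !disc2 -aE -bE -cE.
set D := RHS; have -> : D = D * (M 0 0 * M 1 1 - M 0 1 * M 1 0) ^+ 2.
  by rewrite dM expr1n mulr1.
by rewrite /D; ring.
Qed.

Lemma iso_primitive q q' : iso_pts q q' !=set0 -> primitive q -> primitive q'.
Proof.
move=> [M [_ eM]] [n [r [v sum1]]]; exists n, r, (fun i => M *m v i).
by rewrite -sum1; apply: eq_bigr => i _; rewrite eM.
Qed.

Lemma iso_refl q : iso_pts q q !=set0.
Proof. by exists 1%:M; split=> [|v]; rewrite ?det1 ?mul1mx. Qed.

Lemma iso_sym q q' : iso_pts q q' !=set0 -> iso_pts q' q !=set0.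
Proof. by move=> [M /iso_ptsV]; exists (\adj M). Qed.

Lemma iso_trans q1 q2 q3 : iso_pts q1 q2 !=set0 -> iso_pts q2 q3 !=set0 ->
  iso_pts q1 q3 !=set0.
Proof. by move=> [M isoM] [N isoN]; exists (N *m M); apply: iso_ptsM isoN. Qed.

End Isometries.

Lemma iso_pts_map (R S : comPzRingType) (f : {rmorphism R -> S}) q q' M :
  iso_pts q q' M -> iso_pts (bqf_map f q) (bqf_map f q') (map_mx f M).
Proof.
move=> /iso_ptsP[dM aE cE bE]; apply/iso_ptsP.
rewrite !mxE /= -aE -bE -cE; split; first rewrite -(rmorph1 f) -dM.
all: by rewrite !(rmorphD, rmorphN, rmorphM, rmorphXn, rmorph_nat).
Qed.

Lemma iso_pts_inj (R S : comPzRingType) (f : {rmorphism R -> S}) q q' M :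
  injective f -> iso_pts (bqf_map f q) (bqf_map f q') (map_mx f M) ->
  iso_pts q q' M.
Proof.
move=> f_inj /iso_ptsP[]; rewrite !mxE /= => dM aE cE bE; apply/iso_ptsP.
by split; apply: f_inj;
  rewrite !(rmorphD, rmorphN, rmorphM, rmorphXn, rmorph_nat, rmorph1).
Qed.

(** * Adjoining a square root *)

(** The algebra R[t] / (t^2 - m), free with basis 1, t. *)
Definition quad (R : comPzRingType) (m : R) : Type := (R * R)%type.

Section Quad.
Variables (R : comPzRingType) (m : R).
Local Notation Q := (quad m).

HB.instance Definition _ := GRing.Zmodule.copy Q (R * R)%type.

Definition quad_one : Q := (1, 0).
Definition quad_mul (x y : Q) : Q :=
  (x.1 * y.1 + m * (x.2 * y.2), x.1 * y.2 + x.2 * y.1).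

Fact quad_mulA : associative quad_mul.
Proof. by move=> x y z; congr pair => /=; ring. Qed.
Fact quad_mulC : commutative quad_mul.
Proof. by move=> x y; congr pair => /=; ring. Qed.
Fact quad_mul1 : left_id quad_one quad_mul.
Proof. by move=> [x y]; congr pair => /=; ring. Qed.
Fact quad_mulDl : left_distributive quad_mul +%R.
Proof. by move=> x y z; congr pair => /=; ring. Qed.

HB.instance Definition _ := GRing.Zmodule_isComPzRing.Build Q
  quad_mulA quad_mulC quad_mul1 quad_mulDl.

Definition quad_in (x : R) : Q := (x, 0).
Definition quad_sqrt : Q := (0, 1).
Definition quad_conj (x : Q) : Q := (x.1, - x.2).

Fact quad_in_zmod : zmod_morphism quad_in.
Proof. by move=> x y; congr pair; rewrite subrr. Qed.
Fact quad_in_monoid : monoid_morphism quad_in.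
Proof. by split=> // x y; congr pair; rewrite /=; ring. Qed.
HB.instance Definition _ := GRing.isZmodMorphism.Build R Q quad_in quad_in_zmod.
HB.instance Definition _ :=
  GRing.isMonoidMorphism.Build R Q quad_in quad_in_monoid.

Fact quad_conj_zmod : zmod_morphism quad_conj.
Proof. by move=> x y; congr pair; rewrite opprD. Qed.
Fact quad_conj_monoid : monoid_morphism quad_conj.
Proof.
by split=> [|x y]; congr pair; rewrite /= ?oppr0 //; ring.
Qed.
HB.instance Definition _ :=
  GRing.isZmodMorphism.Build Q Q quad_conj quad_conj_zmod.
HB.instance Definition _ :=
  GRing.isMonoidMorphism.Build Q Q quad_conj quad_conj_monoid.

Lemma quad_sqrt_sqr : quad_sqrt ^+ 2 = quad_in m.
Proof. by rewrite expr2; congr pair; rewrite /=; ring. Qed.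

Lemma quad_in_inj : injective quad_in.
Proof. by move=> x y []. Qed.

Lemma quad_conj_in x : quad_conj (quad_in x) = quad_in x.
Proof. by rewrite /quad_conj /= oppr0. Qed.

(** As 2 is invertible, R is the fixed subring of the conjugation t -> - t. *)
Lemma quad_conj_fix (h : R) (x : Q) :
  2%:R * h = 1 -> quad_conj x = x -> x = quad_in x.1.
Proof.
case: x => x y half [eqy]; congr pair => /=.
by rewrite -[y]mul1r -half mulrAC mulr_natl mulr2n -[X in X + _]eqy addNr mul0r.
Qed.

Lemma quad_conj_fix_mx (h : R) n p (M : 'M[Q]_(n, p)) :
  2%:R * h = 1 -> map_mx quad_conj M = M ->
  exists N : 'M[R]_(n, p), M = map_mx quad_in N.
Proof.
move=> half /matrixP fixM; exists (map_mx fst M); apply/matrixP => i j.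
by rewrite !mxE; apply: (quad_conj_fix half); have := fixM i j; rewrite mxE.
Qed.

End Quad.

Section QuadMap.
Variables (R S : comPzRingType) (g : {rmorphism R -> S}) (m : R).

Definition quad_map (x : quad m) : quad (g m) := (g x.1, g x.2).

Fact quad_map_zmod : zmod_morphism quad_map.
Proof. by move=> x y; congr pair; rewrite rmorphB. Qed.
Fact quad_map_monoid : monoid_morphism quad_map.
Proof.
split=> [|x y]; first by congr pair; rewrite ?rmorph1 ?rmorph0.
by congr pair; rewrite /= !(rmorphD, rmorphM).
Qed.
HB.instance Definition _ :=
  GRing.isZmodMorphism.Build (quad m) (quad (g m)) quad_map quad_map_zmod.
HB.instance Definition _ :=
  GRing.isMonoidMorphism.Build (quad m) (quad (g m)) quad_map quad_map_monoid.

Lemma quad_map_in x : quad_map (quad_in m x) = quad_in (g m) (g x).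
Proof. by congr pair; rewrite rmorph0. Qed.

End QuadMap.

(** * Uniqueness of sums of torsors, locally *)

Section Torsors.
Variable A : comNzRingType.
Implicit Types (q : bqf A).

(** The morphisms of which [torsor_sum] asserts the existence. *)
Definition torsor_mor q q1 q2 q3
    (phi : forall R : comPzRingType, {rmorphism A -> R} ->
      'M[R]_2 -> 'M[R]_2 -> 'M[R]_2) : Prop :=
  [/\ forall (R : comPzRingType) (f : {rmorphism A -> R}) (x y : 'M[R]_2),
        iso_pts (bqf_map f q) (bqf_map f q1) x ->
        iso_pts (bqf_map f q) (bqf_map f q2) y ->
        iso_pts (bqf_map f q) (bqf_map f q3) (phi R f x y),
      forall (R S : comPzRingType) (f : {rmorphism A -> R})
          (h : {rmorphism A -> S}) (g : {rmorphism R -> S}) (x y : 'M[R]_2),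
        (forall a, g (f a) = h a) ->
        iso_pts (bqf_map f q) (bqf_map f q1) x ->
        iso_pts (bqf_map f q) (bqf_map f q2) y ->
        phi S h (map_mx g x) (map_mx g y) = map_mx g (phi R f x y)
    & forall (R : comPzRingType) (f : {rmorphism A -> R}) (x y g : 'M[R]_2),
        iso_pts (bqf_map f q) (bqf_map f q1) x ->
        iso_pts (bqf_map f q) (bqf_map f q2) y ->
        iso_pts (bqf_map f q) (bqf_map f q) g ->
        phi R f (x *m g) y = phi R f x y *m g /\
        phi R f x (y *m g) = phi R f x y *m g].

Lemma iso_pts_eqmap (R S : comPzRingType) (f : {rmorphism A -> R})
    (h : {rmorphism A -> S}) (g : {rmorphism R -> S}) q q' (x : 'M[R]_2) :
  (forall a, g (f a) = h a) -> iso_pts (bqf_map f q) (bqf_map f q') x ->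
  iso_pts (bqf_map h q) (bqf_map h q') (map_mx g x).
Proof.
move=> gf /(iso_pts_map g); rewrite /bqf_map /=.
by rewrite !gf.
Qed.

(** Isometries of forms over the base induce equivariant isomorphisms of
torsors, so only proper classes matter. *)
Lemma torsor_sum_iso q q1 q2 q3 q1' q2' q3' :
  iso_pts q1' q1 !=set0 -> iso_pts q2' q2 !=set0 -> iso_pts q3 q3' !=set0 ->
  torsor_sum q q1 q2 q3 -> torsor_sum q q1' q2' q3'.
Proof.
move=> [h1 iso1] [h2 iso2] [h3 iso3] [phi [phi_iso phi_nat phi_eqv]].
exists (fun (R : comPzRingType) (f : {rmorphism A -> R}) (x y : 'M[R]_2) =>
  map_mx f h3 *m phi R f (map_mx f h1 *m x) (map_mx f h2 *m y)).
have to1 (R : comPzRingType) (f : {rmorphism A -> R}) x :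
    iso_pts (bqf_map f q) (bqf_map f q1') x ->
    iso_pts (bqf_map f q) (bqf_map f q1) (map_mx f h1 *m x).
  by move=> hx; apply: iso_ptsM hx _; apply: iso_pts_map.
have to2 (R : comPzRingType) (f : {rmorphism A -> R}) x :
    iso_pts (bqf_map f q) (bqf_map f q2') x ->
    iso_pts (bqf_map f q) (bqf_map f q2) (map_mx f h2 *m x).
  by move=> hx; apply: iso_ptsM hx _; apply: iso_pts_map.
split=> [R f x y hx hy|R S f h g x y gf hx hy|R f x y g hx hy hg].
- apply: (iso_ptsM (phi_iso _ _ _ _ (to1 _ _ _ hx) (to2 _ _ _ hy))).
  exact: iso_pts_map.
- rewrite map_mxM /= -(phi_nat _ _ f h g _ _ gf (to1 _ _ _ hx) (to2 _ _ _ hy)).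
  rewrite !map_mxM -!map_mx_comp.
  have fE (M : 'M[A]_2) : map_mx h M = map_mx (g \o f) M.
    by apply: eq_map_mx => a /=; rewrite gf.
  by rewrite !fE.
- have [e1 e2] := phi_eqv _ _ _ _ g (to1 _ _ _ hx) (to2 _ _ _ hy) hg.
  by rewrite !mulmxA e1 e2 !mulmxA.
Qed.

Section Ratio.
Variables (q q1 q2 q3 q4 : bqf A).
Variables (phi3 phi4 : forall R : comPzRingType, {rmorphism A -> R} ->
      'M[R]_2 -> 'M[R]_2 -> 'M[R]_2).
Hypothesis phi3P : torsor_mor q q1 q2 q3 phi3.
Hypothesis phi4P : torsor_mor q q1 q2 q4 phi4.

(** The matrix carrying phi3 (x, y) to phi4 (x, y), since \adj inverts
matrices of determinant 1. *)
Definition ratio (R : comPzRingType) (f : {rmorphism A -> R}) x y : 'M[R]_2 :=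
  phi4 f x y *m \adj (phi3 f x y).

Lemma ratio_iso (R : comPzRingType) (f : {rmorphism A -> R}) x y :
  iso_pts (bqf_map f q) (bqf_map f q1) x ->
  iso_pts (bqf_map f q) (bqf_map f q2) y ->
  iso_pts (bqf_map f q3) (bqf_map f q4) (ratio f x y).
Proof.
case: phi3P phi4P => [i3 _ _] [i4 _ _] hx hy.
exact: iso_ptsM (iso_ptsV (i3 _ _ _ _ hx hy)) (i4 _ _ _ _ hx hy).
Qed.

Lemma ratioE (R : comPzRingType) (f : {rmorphism A -> R}) x y :
  iso_pts (bqf_map f q) (bqf_map f q1) x ->
  iso_pts (bqf_map f q) (bqf_map f q2) y ->
  phi4 f x y = ratio f x y *m phi3 f x y.
Proof.
case: phi3P => [i3 _ _] hx hy; have [d3 _] := i3 _ _ _ _ hx hy.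
by rewrite /ratio -mulmxA mul_adj_mx d3 mulmx1.
Qed.

Lemma ratio_eq (R : comPzRingType) (f : {rmorphism A -> R}) x y N :
  iso_pts (bqf_map f q) (bqf_map f q1) x ->
  iso_pts (bqf_map f q) (bqf_map f q2) y ->
  phi4 f x y = N *m phi3 f x y -> N = ratio f x y.
Proof.
case: phi3P => [i3 _ _] hx hy; have [d3 _] := i3 _ _ _ _ hx hy.
by rewrite /ratio => ->; rewrite -mulmxA mul_mx_adj d3 mulmx1.
Qed.

Lemma ratio_map (R S : comPzRingType) (f : {rmorphism A -> R})
    (h : {rmorphism A -> S}) (g : {rmorphism R -> S}) x y :
  (forall a, g (f a) = h a) ->
  iso_pts (bqf_map f q) (bqf_map f q1) x ->
  iso_pts (bqf_map f q) (bqf_map f q2) y ->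
  ratio h (map_mx g x) (map_mx g y) = map_mx g (ratio f x y).
Proof.
case: phi3P phi4P => [_ n3 _] [_ n4 _] gf hx hy.
by rewrite /ratio (n3 _ _ f h g) // (n4 _ _ f h g) // map_mxM map_mx_adj.
Qed.

(** The torsors being simply transitive, x' = x g and y' = y g' with g, g' in
SO_q; equivariance multiplies phi3 and phi4 by the same g' g on the right,
which cancels in the ratio. *)
Lemma ratio_indep (R : comPzRingType) (f : {rmorphism A -> R}) x y x' y' :
  iso_pts (bqf_map f q) (bqf_map f q1) x ->
  iso_pts (bqf_map f q) (bqf_map f q2) y ->
  iso_pts (bqf_map f q) (bqf_map f q1) x' ->
  iso_pts (bqf_map f q) (bqf_map f q2) y' ->
  ratio f x y = ratio f x' y'.
Proof.
move=> hx hy hx' hy'; apply: ratio_eq => //.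
pose g := \adj x *m x'; pose g' := \adj y *m y'.
have hg : iso_pts (bqf_map f q) (bqf_map f q) g := iso_ptsM hx' (iso_ptsV hx).
have hg' : iso_pts (bqf_map f q) (bqf_map f q) g' := iso_ptsM hy' (iso_ptsV hy).
have <- : x *m g = x' := iso_pts_adjVK _ hx.
have <- : y *m g' = y' := iso_pts_adjVK _ hy.
have hyg : iso_pts (bqf_map f q) (bqf_map f q2) (y *m g') := iso_ptsM hg' hy.
case: phi3P phi4P => [_ _ e3] [_ _ e4].
rewrite (e3 _ _ _ _ _ hx hyg hg).1 (e4 _ _ _ _ _ hx hyg hg).1.
rewrite (e3 _ _ _ _ _ hx hy hg').2 (e4 _ _ _ _ _ hx hy hg').2.
by rewrite !mulmxA -ratioE.
Qed.

(** The conjugate of a point over R[t] / (t^2 - m) is another point, so the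
ratio is conjugation invariant by [ratio_indep] and has entries in R.  The
universal property of the result, over all R-algebras, is what allows the
comparison of ratios descended from different m and different R. *)
Lemma ratio_descent (R : comPzRingType) (f : {rmorphism A -> R}) (h m : R) x y :
  2%:R * h = 1 ->
  iso_pts (bqf_map (quad_in m \o f) q) (bqf_map (quad_in m \o f) q1) x ->
  iso_pts (bqf_map (quad_in m \o f) q) (bqf_map (quad_in m \o f) q2) y ->
  exists2 N, iso_pts (bqf_map f q3) (bqf_map f q4) N &
    forall (S : comPzRingType) (g : {rmorphism R -> S})
        (k : {rmorphism A -> S}) (x y : 'M[S]_2),
      (forall a, g (f a) = k a) ->
      iso_pts (bqf_map k q) (bqf_map k q1) x ->
      iso_pts (bqf_map k q) (bqf_map k q2) y ->
      ratio k x y = map_mx g N.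
Proof.
set j := (j in bqf_map j _) => half hx hy.
pose N0 := ratio j x y.
have conjj a : quad_conj (j a) = j a by rewrite /j /= quad_conj_in.
have hx' := iso_pts_eqmap (g := @quad_conj _ m) conjj hx.
have hy' := iso_pts_eqmap (g := @quad_conj _ m) conjj hy.
have N0fix : map_mx (@quad_conj _ m) N0 = N0.
  by have <- := ratio_map conjj hx hy; apply: ratio_indep hx' hy' hx hy.
have [N N0E] := quad_conj_fix_mx half N0fix.
have N0iso : iso_pts (bqf_map j q3) (bqf_map j q4) N0 := ratio_iso hx hy.
exists N.
  by rewrite N0E in N0iso; apply: (iso_pts_inj (@quad_in_inj _ m)).
move=> S g k x' y' gf hSx hSy.
pose jS := quad_in (g m) \o k : {rmorphism A -> quad (g m)}.
have jj a : quad_map g (j a) = jS a by rewrite /j /jS /= quad_map_in gf.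
have inj_mx : injective (map_mx (quad_in (g m)) : 'M[S]_2 -> 'M_2).
  move=> M M' /matrixP eM; apply/matrixP => i l; have := eM i l; rewrite !mxE.
  exact: quad_in_inj.
(* S[t] / (t^2 - m) carries both the given points of S and the points x, y. *)
apply: inj_mx; rewrite -(ratio_map (h := jS)) //.
pose G := map_mx (@quad_map _ _ g m) : 'M_2 -> 'M_2.
transitivity (ratio jS (G x) (G y)).
  apply: ratio_indep.
  - exact: (iso_pts_map _ hSx).
  - exact: (iso_pts_map _ hSy).
  - exact: (iso_pts_eqmap jj hx).
  - exact: (iso_pts_eqmap jj hy).
rewrite (ratio_map jj hx hy) -/N0 N0E -!map_mx_comp.
by apply: eq_map_mx => a /=; rewrite quad_map_in.
Qed.

End Ratio.
End Torsors.

(** * Squaring a united form *)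

Section Frames.
Variable R : comPzRingType.
Implicit Types a b c x y h : R.

(** In the basis defining (a, 2b, c), multiplication by the square root of
b^2 - ac is J = ((-b, -c), (a, b)).  The frame of a vector u has columns u
and J u, and determinant the value of the form at u. *)
Definition frame a b c x y : 'M[R]_2 :=
  mx2 x (- (b * x + c * y)) y (a * x + b * y).

Lemma frame_iso a b c x y :
  a * x ^+ 2 + 2%:R * b * (x * y) + c * y ^+ 2 = 1 ->
  iso_pts (Bqf 1 0 (- (b ^+ 2 - a * c))) (Bqf a (2%:R * b) c) (frame a b c x y).
Proof.
move=> qxy; apply/iso_ptsP; rewrite /frame !mxE /=; split; last ring.
- by rewrite -[RHS]qxy; ring.
- exact: qxy.
- by rewrite -[RHS]mulr1 -[in RHS]qxy; ring.
Qed.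

(** Thus Iso(q, (a, 2b, c)) is the conic of vectors at which the form takes the
value 1: an isometry commutes with multiplication by the square root, which
for q sends e1 to e2. *)
Lemma iso_frame h a b c M : 2%:R * h = 1 ->
  iso_pts (Bqf 1 0 (- (b ^+ 2 - a * c))) (Bqf a (2%:R * b) c) M ->
  M = frame a b c (M 0 0) (M 1 0).
Proof.
move=> half /iso_ptsP /= [dM aE _ bE].
set x := M 0 0 in dM aE bE *; set y := M 1 0 in dM aE bE *.
set z := M 0 1 in dM bE *; set t := M 1 1 in dM bE *.
have bE' : z * (a * x + b * y) + t * (b * x + c * y) = 0.
  by rewrite -[LHS]mul1r -half -[RHS](mulr0 h) -bE; ring.
apply: mx2_ext; rewrite !mxE //= -/x -/y -/z -/t.
  have -> : z = z * 1 by rewrite mulr1.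
  rewrite -{1}aE.
  rewrite (_ : z * _ = x * (z * (a * x + b * y)) + z * (b * x + c * y) * y);
    last ring.
  rewrite (canRL (addrK _) bE').
  rewrite -[RHS]mulr1 -dM; ring.
have -> : t = t * 1 by rewrite mulr1.
rewrite -{1}aE.
rewrite (_ : t * _ = t * (a * x + b * y) * x + y * (t * (b * x + c * y)));
  last ring.
rewrite (canRL (addKr _) bE').
rewrite -[RHS]mulr1 -dM; ring.
Qed.

End Frames.

Section Doubling.
Variables (R : comPzRingType) (a b c h : R).
Hypothesis half : 2%:R * h = 1.

(** With s the square root of b^2 - a^2 c, the three forms are the norm forms,
divided by the norm of the module, of the modules with bases (1, s),
(a, b + s) and (a^2, b + s); the third module is the square of the second. *)
Definition base_form := Bqf 1 0 (- (b ^+ 2 - a * (a * c))).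
Definition united_form := Bqf a (2%:R * b) (a * c).
Definition double_form := Bqf (a ^+ 2) (2%:R * b) c.

(** The coordinates of (a x1 + (b + s) y1) (a x2 + (b + s) y2) in the basis
(a^2, b + s) (up to the order of the factors, the Gauss composition law). *)
Definition compose_x (x1 y1 x2 y2 : R) := x1 * x2 - c * (y1 * y2).
Definition compose_y (x1 y1 x2 y2 : R) :=
  a * (x1 * y2 + y1 * x2) + 2%:R * b * (y1 * y2).

Definition compose (x y : 'M[R]_2) : 'M[R]_2 :=
  let u := compose_x (x 0 0) (x 1 0) (y 0 0) (y 1 0) in
  let v := compose_y (x 0 0) (x 1 0) (y 0 0) (y 1 0) in
  frame (a ^+ 2) b c u v.

Lemma compose_valE x1 y1 x2 y2 :
  a ^+ 2 * compose_x x1 y1 x2 y2 ^+ 2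
    + 2%:R * b * (compose_x x1 y1 x2 y2 * compose_y x1 y1 x2 y2)
    + c * compose_y x1 y1 x2 y2 ^+ 2 =
  (a * x1 ^+ 2 + 2%:R * b * (x1 * y1) + a * c * y1 ^+ 2) *
  (a * x2 ^+ 2 + 2%:R * b * (x2 * y2) + a * c * y2 ^+ 2).
Proof. by rewrite /compose_x /compose_y; ring. Qed.

Lemma base_form_double : base_form = Bqf 1 0 (- (b ^+ 2 - a ^+ 2 * c)).
Proof. by rewrite /base_form mulrA expr2. Qed.

Lemma compose_iso x y :
  iso_pts base_form united_form x -> iso_pts base_form united_form y ->
  iso_pts base_form double_form (compose x y).
Proof.
move=> /iso_ptsP[_ qx _ _] /iso_ptsP[_ qy _ _].
rewrite base_form_double; apply: frame_iso.
by rewrite compose_valE qx qy mulr1.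
Qed.

Lemma composeC x y : compose x y = compose y x.
Proof. by rewrite /compose /compose_x /compose_y; congr frame; ring. Qed.

Lemma compose_equivariant x y g :
  iso_pts base_form united_form x -> iso_pts base_form united_form y ->
  iso_pts base_form base_form g -> compose (x *m g) y = compose x y *m g.
Proof.
move=> hx hy hg; have := iso_ptsM hg (compose_iso hx hy).
rewrite {1}base_form_double => /(iso_frame half) ->.
rewrite {1}/compose !mulmx2 (iso_frame half hx) !mxE /= /compose_x /compose_y.
by congr frame; ring.
Qed.

(** The vector of value 1 is w^2 / m, for w the vector at which the united form
takes the unit value m. *)
Lemma double_local (x y m' : R) :
  (a * x ^+ 2 + 2%:R * b * (x * y) + a * c * y ^+ 2) * m' = 1 ->
  iso_pts base_form double_form !=set0.
Proof.
move=> m_unit; rewrite base_form_double.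
exists (frame (a ^+ 2) b c (m' * compose_x x y x y) (m' * compose_y x y x y)).
apply: frame_iso.
set m := (X in X * _ = _) in m_unit.
transitivity (m' ^+ 2 * (m * m)).
  by rewrite /m -compose_valE; ring.
by rewrite -[RHS](expr1n _ 2) -m_unit; ring.
Qed.

End Doubling.

Section DoublingMap.
Variables (R S : comPzRingType) (f : {rmorphism R -> S}) (a b c : R).

Lemma base_form_map :
  bqf_map f (base_form a b c) = base_form (f a) (f b) (f c).
Proof.
by rewrite /base_form /bqf_map /= !(rmorphN, rmorphD, rmorphM, rmorphXn)
  rmorph0 rmorph1.
Qed.

Lemma united_form_map :
  bqf_map f (united_form a b c) = united_form (f a) (f b) (f c).
Proof. by rewrite /united_form /bqf_map /= !(rmorphM, rmorph_nat). Qed.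

Lemma double_form_map :
  bqf_map f (double_form a b c) = double_form (f a) (f b) (f c).
Proof.
by rewrite /double_form /bqf_map /= !(rmorphXn, rmorphM, rmorph_nat).
Qed.

End DoublingMap.

(** If w has value m = t^2 then w / t has value 1; as t^-1 = t / m, the witness
is t m' w. *)
Lemma united_quad_point (R : comPzRingType) (a b c x y m m' : R) :
  a * x ^+ 2 + 2%:R * b * (x * y) + a * c * y ^+ 2 = m -> m * m' = 1 ->
  iso_pts (bqf_map (quad_in m) (base_form a b c))
          (bqf_map (quad_in m) (united_form a b c)) !=set0.
Proof.
move=> qxy m_unit; rewrite base_form_map united_form_map.
pose i : {rmorphism R -> quad m} := quad_in m.
have im :
    i m = i a * i x ^+ 2 + 2%:R * i b * (i x * i y) + i a * i c * i y ^+ 2.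
  transitivity (i (a * x ^+ 2 + 2%:R * b * (x * y) + a * c * y ^+ 2)).
    by rewrite qxy.
  by rewrite !(rmorphD, rmorphM, rmorphXn, rmorph_nat).
have im' : i m * i m' = 1 by rewrite -rmorphM m_unit rmorph1.
pose t := quad_sqrt m * i m'.
exists (frame (i a) (i b) (i a * i c) (t * i x) (t * i y)); apply: frame_iso.
transitivity (quad_sqrt m ^+ 2 * (i m' ^+ 2 * i m));
  first by rewrite im /t; ring.
by rewrite quad_sqrt_sqr -[RHS](expr1n _ 2) -im'; ring.
Qed.

Section DoublingTorsor.
Variables (A : comNzRingType) (a b c h : A).
Hypothesis half : 2%:R * h = 1.

Lemma double_torsor_sum : torsor_sum (base_form a b c)
  (united_form a b c) (united_form a b c) (double_form a b c).
Proof.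
exists (fun (R : comPzRingType) (f : {rmorphism A -> R}) (x y : 'M[R]_2) =>
  compose (f a) (f b) (f c) x y).
have halff (R : comPzRingType) (f : {rmorphism A -> R}) : 2%:R * f h = 1.
  by rewrite -(rmorph_nat f) -rmorphM half rmorph1.
split=> [R f x y|R S f g' g x y gf _ _|R f x y g].
- rewrite base_form_map united_form_map double_form_map; exact: compose_iso.
- rewrite -!gf; apply: mx2_ext; rewrite /compose /compose_x /compose_y !mxE /=;
    by rewrite !(rmorph_nat, rmorphN, rmorphD, rmorphM, rmorphXn).
- rewrite base_form_map united_form_map => hx hy hg.
  rewrite (compose_equivariant (halff R f)) //; split=> //.
  by rewrite composeC (compose_equivariant (halff R f)) // composeC.
Qed.

End DoublingTorsor.

(** * Quotients of a ring algebraic over polynomials *)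

Section PiRegular.
Variables (F : fieldType) (A : comNzRingType).
Variable iota : {rmorphism {poly F} -> A}.
Hypothesis A_domain : forall x y : A, x * y = 0 -> x != 0 -> y = 0.
Hypothesis iota_inj : injective iota.
Hypothesis A_alg : forall x : A, exists2 P : {poly {poly F}},
  P != 0 & (map_poly iota P).[x] = 0.

(** Strong pi-regularity of x in A / (n). *)
Definition pi_regular (n x : A) : Prop :=
  exists i u w, x ^+ i * (1 - x * u) = n * w.

Lemma pi_regular_dvd n d x : pi_regular (n * d) x -> pi_regular n x.
Proof. by move=> [i [u [w eq]]]; exists i, u, (d * w); rewrite eq mulrA. Qed.

Lemma pi_regularM n n' x :
  pi_regular n x -> pi_regular n' x -> pi_regular (n * n') x.
Proof.
move=> [i [u [w eq]]] [i' [u' [w' eq']]].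
exists (i + i')%N, (u + u' - x * u * u'), (w * w').
transitivity (x ^+ i * (1 - x * u) * (x ^+ i' * (1 - x * u'))).
  by rewrite exprD; ring.
by rewrite eq eq'; ring.
Qed.

(** Reduce P modulo p: its lowest nonzero term can be solved for a power of x,
as its coefficient is invertible modulo p. *)
Lemma pi_regular_coef_prime (p : {poly F}) (P : {poly {poly F}}) (x : A) :
  irreducible_poly p -> (exists i, ~~ (p %| P`_i)) ->
  exists i u y z,
    x ^+ i * (1 - x * u) = (map_poly iota P).[x] * y + iota p * z.
Proof.
move=> p_irr; elim/poly_ind: P => [[i]|P c IHP [i]].
  by rewrite coef0 dvdp0.
rewrite rmorphD rmorphM /= map_polyX map_polyC !hornerE /=.
have [p_c|] := boolP (p %| c).
  case: i => [|i]; first by rewrite coefD coefMX coefC add0r p_c.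
  rewrite coefD coefMX coefC addr0 /= => p_Pi.
  have [j [u [y [z eq]]]] := IHP (ex_intro (fun j => is_true (~~ (p %| P`_j)))
    i p_Pi).
  have /dvdpP[d ->] := p_c; exists j.+1, u, y, (x * z - iota d * y).
  by rewrite exprS -mulrA eq rmorphM; ring.
rewrite -irreducible_poly_coprime // => /Bezout_eq1_coprimepP[[s t] /= st1] _.
have {}st1 : iota s * iota p + iota t * iota c = 1.
  by rewrite -!rmorphM -rmorphD st1 rmorph1.
exists 0%N, (- iota t * (map_poly iota P).[x]), (iota t), (iota s).
by rewrite expr0 -[in X in X - _]st1; ring.
Qed.

(** An annihilator divisible by p can be divided by p, which lowers the degree
of its leading coefficient. *)
Lemma annihilator_prime (p : {poly F}) (x : A) : irreducible_poly p ->
  exists2 P : {poly {poly F}}, exists i, ~~ (p %| P`_i)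
    & (map_poly iota P).[x] = 0.
Proof.
move=> p_irr; have [P] := A_alg x.
have [n] := ubnP (size (lead_coef P)); elim: n P => // n IHn P lt_P_n P0 Px.
have [|p_dvd] := pselect (exists i, ~~ (p %| P`_i)); first by exists P.
have {}p_dvd i : p %| P`_i by apply/negPn/negP => ndvd; case: p_dvd; exists i.
have p0 : p != 0 by apply: irredp_neq0.
pose P' := \poly_(i < size P) (P`_i %/ p).
have eqP : P = p *: P'.
  apply/polyP => i; rewrite coefZ coef_poly;
    case: ltnP => [_|/(nth_default 0) ->].
    by rewrite mulrC divpK.
  by rewrite mulr0.
have P'0 : P' != 0 by apply: contra_neq P0; rewrite eqP => ->; rewrite scaler0.
apply: (IHn P') => //.
  rewrite -ltnS; apply: leq_trans lt_P_n; rewrite ltnS.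
  rewrite {1}eqP lead_coefZ size_mul ?lead_coef_eq0 //.
  have [p1 _] := p_irr.
  by case: (size p) p1 => [|[|m]] //= _; rewrite addSn ltnS leq_addl.
apply: (@A_domain (iota p)); last by rewrite raddf_eq0.
by rewrite -Px [in RHS]eqP -mul_polyC rmorphM /= map_polyC hornerM hornerC.
Qed.

(** By multiplicativity it suffices to treat irreducible n. *)
Lemma pi_regular_poly (n : {poly F}) (x : A) : n != 0 -> pi_regular (iota n) x.
Proof.
have [m] := ubnP (size n); elim: m n => // m IHm n; rewrite ltnS => le_n_m n0.
have [n_irr|n_red] := pselect (irreducible_poly n).
  have [P coefP Px] := annihilator_prime x n_irr.
  have [i [u [y [z eq]]]] := pi_regular_coef_prime x n_irr coefP.
  by exists i, u, z; rewrite eq Px mul0r add0r.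
have [n1|n_gt1] := leqP (size n) 1.
  have [c c0 ->] : exists2 c, c != 0 & n = c%:P.
    by apply/size_poly1P; rewrite eqn_leq n1 size_poly_gt0.
  exists 0%N, 0, (iota c^-1%:P).
  by rewrite expr0 -rmorphM -polyCM divff // rmorph1 mulr0 subr0 mulr1.
have [d d1 [d_n nd_n]] : exists2 d : {poly F}, size d != 1
    & d %| n /\ ~~ (d %= n).
  apply: contrapT => no_d; apply: n_red; split=> // d d1 d_n.
  by apply/negPn/negP => nd_n; apply: no_d; exists d.
have /dvdpP[e eqn] := d_n.
have [e0 d0] : e != 0 /\ d != 0.
  by apply/andP; rewrite -negb_or -mulf_eq0 -eqn.
have d_gt1 : (1 < size d)%N by rewrite ltn_neqAle eq_sym d1 size_poly_gt0.
have lt_d_n : (size d < size n)%N.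
  by rewrite ltn_neqAle dvdp_leq // andbT (dvdp_size_eqp d_n).
have lt_e_n : (size e < size n)%N.
  rewrite eqn size_mul //; case: (size d) d_gt1 => [|[|k]] // _.
  by rewrite !addnS /= ltnS leq_addr.
rewrite eqn rmorphM; apply: pi_regularM.
  by apply: IHm e0; apply: leq_trans lt_e_n le_n_m.
by apply: IHm d0; apply: leq_trans lt_d_n le_n_m.
Qed.

(** An annihilator of b can be divided by X until its constant term, which is
then a multiple of b, is nonzero. *)
Lemma dvd_poly b : b != 0 ->
  exists2 n : {poly F}, n != 0 & exists d, iota n = b * d.
Proof.
move=> b0; have [P] := A_alg b; elim/poly_ind: P => [|P c IHP];
  first by rewrite eqxx.
have [->|c0 _] := eqVneq c 0.
  rewrite polyC0 addr0 rmorphM /= map_polyX hornerMX => PX0 Pb.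
  apply: IHP; first by apply: contra_neq PX0 => P0; rewrite P0 mul0r.
  by apply: A_domain b0; rewrite mulrC.
rewrite rmorphD rmorphM /= map_polyX map_polyC !hornerE /= => Pb.
exists c => //; exists (- (map_poly iota P).[b]).
by apply/eqP; rewrite -subr_eq0 -Pb; apply/eqP; ring.
Qed.

Lemma pi_regularW b x : b != 0 -> pi_regular b x.
Proof.
move=> /dvd_poly[n n0 [d eqn]]; apply: (@pi_regular_dvd b d).
by rewrite -eqn; apply: pi_regular_poly.
Qed.

End PiRegular.

(** * United forms in a primitive class *)

Section Dirichlet.
Variables (A : comNzRingType) (h alpha : A).
Hypothesis half : 2%:R * h = 1.

Lemma primitive_coefs a b c :
  primitive (Bqf a b c) -> exists x y z : A, x * a + y * b + z * c = 1.
Proof.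
move=> [n [r [v sum1]]].
exists (\sum_i r i * v i 0 0 ^+ 2), (\sum_i r i * (v i 0 0 * v i 1 0)),
  (\sum_i r i * v i 1 0 ^+ 2).
rewrite !mulr_suml -!big_split -[RHS]sum1; apply: eq_bigr => i _ /=.
by rewrite /bqf_eval /=; ring.
Qed.

Lemma coef_primitive a b c (x y z : A) :
  x * a + y * b + z * c = 1 -> primitive (Bqf a b c).
Proof.
move=> eq1; exists 3, (fun i => [:: x - y; y; z - y]`_i),
  (fun i => [:: col2 1 0; col2 1 1; col2 0 1]`_i).
by rewrite !big_ord_recl big_ord0 /bqf_eval /= !mxE /= -[RHS]eq1; ring.
Qed.

(** Take t = 1 - a u with a^i t = 0 modulo alpha.  A prime containing alpha
contains a or t, and not both.  If it contains t, the value at (1, t) is a,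
nonzero there.  If it contains a, it contains b, so that t = 1 and the value
is c, nonzero there since the form is primitive.  The proof spells this out
in the ideal I = (m, alpha), m being the value: a^i is in I because m and t
are comaximal, and I and a are comaximal, so that 1 is in I. *)
Lemma coprime_value a b c :
  b ^+ 2 - a * c = alpha -> (exists x y z : A, x * a + y * b + z * c = 1) ->
  pi_regular alpha a ->
  exists t r s, (a + 2%:R * b * t + c * t ^+ 2) * r + alpha * s = 1.
Proof.
move=> disc_q [x [y [z prim]]] [i [u [w reg]]].
exists (1 - a * u); set t := 1 - a * u in reg *.
set m := a + _ + _.
pose inI e := exists r s, m * r + alpha * s = e.
(* 1 = u m + t (...), multiplied by a^i. *)
have inI0 e : inI (a ^+ i * e).
  have mt : u * m + t * (1 - u * (2%:R * b + c * t)) = 1 by rewrite /m /t; ring.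
  exists (a ^+ i * e * u), (w * e * (1 - u * (2%:R * b + c * t))).
  rewrite -[RHS]mulr1 -[in RHS]mt.
  transitivity (m * (a ^+ i * e * u)
    + (alpha * w) * (e * (1 - u * (2%:R * b + c * t)))).
    by ring.
  by rewrite -reg; ring.
(* Modulo (m, a), c = - 2b and primitivity reads b b' = 1, while
   b^2 = alpha + a c. *)
have step : exists d X Y, m * X + alpha * Y + a * d = 1.
  pose b' := y - 2%:R * z.
  have [z1 [z2 zE]] : exists z1 z2, b * b' + (m * z1 + a * z2) = 1.
    exists z, (x - z * (1 + 2%:R * b * (- u) + c * (- u *+ 2 + a * u ^+ 2))).
    rewrite -[RHS]prim /b' /m /t; ring.
  pose Z := m * z1 + a * z2.
  exists (c * b' ^+ 2 + z2 * (2%:R * b * b' + Z)), (z1 * (2%:R * b * b' + Z)),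
    (b' ^+ 2).
  rewrite -[RHS](expr1n _ 2) -[X in _ = X ^+ 2]zE -disc_q /Z; ring.
case: step => d [X [Y one_eq]].
have down j : (forall e, inI (a ^+ j * e)) -> inI 1.
  elim: j => [/(_ 1)|j IHj hj]; first by rewrite mulr1.
  apply: IHj => e; have [r [s rs]] := hj (d * e).
  exists (r + a ^+ j * e * X), (s + a ^+ j * e * Y).
  rewrite -[RHS]mulr1 -[in RHS]one_eq.
  transitivity ((m * r + alpha * s) + a ^+ j * e * (m * X + alpha * Y));
    first by ring.
  by rewrite rs exprS; ring.
exact: down inI0.
Qed.

(** A first change of basis makes the leading coefficient a coprime to alpha,
hence to b; then b can be translated by a multiple of a so as to satisfy
b^2 = alpha modulo a^2. *)
Lemma united_representative q :
  (forall a, pi_regular alpha a) -> primitive q ->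
  disc q = disc (Bqf 1 0 (- alpha)) ->
  exists a b c, [/\ iso_pts q (united_form a b c) !=set0,
    base_form a b c = Bqf 1 0 (- alpha) & exists r s, a * r + b * s = 1].
Proof.
move=> reg; case: q => a0 d0 c0 /primitive_coefs prim disc_q.
pose b0 := h * d0; have d0E : d0 = 2%:R * b0 by rewrite mulrA half mul1r.
have {}disc_q : b0 ^+ 2 - a0 * c0 = alpha.
  move: disc_q; rewrite !disc2 /= d0E => disc_q.
  have scale z : z = h ^+ 2 * (4%:R * z).
    by transitivity (z * (2%:R * h) ^+ 2); [rewrite half expr1n mulr1 | ring].
  rewrite [LHS]scale [RHS]scale; congr (_ * _).
  transitivity (- (4%:R * a0 * c0 - (2%:R * b0) ^+ 2)); first ring.
  by rewrite disc_q; ring.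
have prim' : exists x y z : A, x * a0 + y * b0 + z * c0 = 1.
  have [x [y [z eq1]]] := prim; exists x, (2%:R * y), z.
  by rewrite -[RHS]eq1 d0E; ring.
have [t [r [s coprime_a]]] := coprime_value disc_q prim' (reg a0).
pose a := a0 + 2%:R * b0 * t + c0 * t ^+ 2; pose b1 := b0 + c0 * t.
have disc_1 : b1 ^+ 2 - a * c0 = alpha by rewrite -disc_q /a /b1; ring.
pose rho := r - c0 * s; pose beta := b1 * s.
have coprime_ab : a * rho + b1 * beta = 1.
  by rewrite -[RHS]coprime_a -/a -disc_1 /rho /beta; ring.
(* c0 + 2 b1 u = 0 modulo a, because b1 beta = 1 modulo a. *)
pose u := - (c0 * beta * h).
pose b := b1 + a * u; pose c := c0 * rho + u ^+ 2.
have acE : a * c = c0 + 2%:R * b1 * u + a * u ^+ 2.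
  have -> : c0 + 2%:R * b1 * u = c0 * (1 - (2%:R * h) * (b1 * beta)).
    by rewrite /u; ring.
  rewrite half mul1r -{1}coprime_ab /c; ring.
exists a, b, c; split.
- apply: iso_sym; exists (mx2 1 u t (1 + t * u)); apply/iso_ptsP.
  rewrite /united_form /= acE d0E !mxE /= /b /a /b1; split; ring.
- by rewrite /base_form acE -disc_1 /b; congr Bqf; ring.
- exists (rho - u * beta), beta; rewrite -[RHS]coprime_ab /b; ring.
Qed.

End Dirichlet.

(** * Algebraicity over the polynomial ring *)

Section ClearDenominators.
Import FracField.

Lemma fractionP (D : idomainType) (z : {fraction D}) :
  exists n d, d != 0 /\ z * tofrac d = tofrac n.
Proof.
exists (frac (repr z)).1, (frac (repr z)).2; split; first exact: denom_ratioP.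
rewrite -{1}[z]reprK; unlock tofrac; rewrite -[LHS]pi_mul; apply/eqmodP.
rewrite /= equivfE /mulf !numden_Ratio ?oner_neq0 ?mulf_neq0 ?mulr1
  ?denom_ratioP ?oner_neq0 //.
by rewrite mulrC.
Qed.

End ClearDenominators.

Lemma clear_denominators (D : idomainType) (P : {poly {fraction D}}) :
  exists2 d : D, d != 0 & exists Q : {poly D},
    (tofrac d) *: P = map_poly (@tofrac D) Q.
Proof.
elim/poly_ind: P => [|P c [d d0 [Q eqQ]]].
  by exists 1; [exact: oner_neq0 | exists 0; rewrite scaler0 rmorph0].
have [n [e [e0 ce]]] := fractionP c.
exists (e * d); first by rewrite mulf_neq0.
exists (e *: Q * 'X + (d * n)%:P).
rewrite [RHS]rmorphD [X in _ = X + _]rmorphM /= map_polyX map_polyC map_polyZ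
  -eqQ.
rewrite /= !rmorphM /= -ce.
rewrite scalerDr scalerAl scalerA; congr (_ + _).
by rewrite -mul_polyC -!polyCM; congr (_ %:P); ring.
Qed.

Lemma fieldext_annihilator (D : idomainType)
    (k : fieldExtType {fraction D}) (x : k) :
  exists2 P : {poly D}, P != 0 &
    (map_poly (in_alg k \o @tofrac D) P).[x] = 0.
Proof.
have /polyOver1P[p pE] := minPolyOver 1%AS x.
have p0 : p != 0.
  apply: contra_neq (monic_neq0 (monic_minPoly 1%AS x)) => p0.
  by rewrite pE p0 rmorph0.
have [d d0 [Q eqQ]] := clear_denominators p.
have d0' : tofrac d != 0 by rewrite tofrac_eq0.
exists Q.
  apply: contra_neq p0 => Q0; apply/eqP.
  by have := scaler_eq0 (tofrac d) p; rewrite eqQ Q0 rmorph0 eqxx (negbTE d0')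
    /= => <-.
rewrite map_poly_comp -eqQ map_polyZ hornerZ -pE.
by have /eqP -> := root_minPoly 1%AS x; rewrite mulr0.
Qed.

(** * Valuation rings of a place *)

Section ValuationRing.
Variables (k : fieldType).
Implicit Types v : place k.

HB.instance Definition _ v :=
  GRing.isSubringClosed.Build k (val_int v) (val_int_closed v).

Record val_ring v := ValRing {
  val_ring_val :> k;
  val_ringP : val_ring_val \in val_int v
}.

HB.instance Definition _ v := [isSub for @val_ring_val v].
HB.instance Definition _ v := [Choice of val_ring v by <:].
HB.instance Definition _ v := [SubChoice_isSubComNzRing of val_ring v by <:].

Lemma placeV v x : x != 0 -> v x^-1 = - v x.
Proof.
move=> x0; apply/eqP; rewrite -addr_eq0 addrC -placeM ?invr_eq0 //.
by rewrite divff // place1.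
Qed.

Lemma placeX v x n : x != 0 -> v (x ^+ n) = v x *+ n.
Proof.
move=> x0; elim: n => [|n IHn]; first by rewrite expr0 place1 mulr0n.
by rewrite exprS placeM ?expf_neq0 // IHn mulrS.
Qed.

Lemma val_ring_unit v (x : val_ring v) :
  val x != 0 -> v (val x) <= 0 -> exists y, x * y = 1.
Proof.
move=> x0 vx; have Vx : (val x)^-1 \in val_int v.
  by rewrite !inE placeV // oppr_ge0 vx orbT.
by exists (ValRing Vx); apply: val_inj; rewrite rmorphM /= divff.
Qed.

(** The valuation ring is local: elements of positive valuation have a sum of
positive valuation. *)
Lemma val_ring_comaximal v (x y r s : val_ring v) :
  x * r + y * s = 1 -> (exists z, x * z = 1) \/ (exists z, y * z = 1).
Proof.
move=> xy1.
have nonunit (z : val_ring v) : ~ (exists z', z * z' = 1) -> forall t,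
    val (z * t) = 0 \/ 0 < v (val (z * t)).
  move=> z_nu t; have [->|zt0] := eqVneq (val (z * t)) 0; [by left | right].
  rewrite ltNge; apply/negP => zt_le0.
  have [y1 ] := val_ring_unit zt0 zt_le0.
  by rewrite -mulrA => ?; apply: z_nu; exists (t * y1).
apply: contrapT => /not_orP[x_nu y_nu].
have one : val (x * r) + val (y * s) = 1 by rewrite -rmorphD xy1 rmorph1.
have [xr0|xr] := nonunit x x_nu r; have [ys0|ys] := nonunit y y_nu s.
- by move: one; rewrite xr0 ys0 addr0 => /esym/eqP; rewrite oner_eq0.
- by move: ys; rewrite -[val (y * s)]add0r -xr0 one place1 ltxx.
- by move: xr; rewrite -[val (x * r)]addr0 -ys0 one place1 ltxx.
have nz z : 0 < v z -> z != 0.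
  by move=> vz; apply: contraL vz => /eqP ->; rewrite place0 ltxx.
have := placeD v (nz _ xr) (nz _ ys); rewrite one oner_neq0 place1 => /(_ isT).
by rewrite leNgt lt_min xr ys.
Qed.

Section Restrict.
Variables (oo v : place k) (v_oo : v <> oo).

Fact away_val_int (x : away_ring oo) : val x \in val_int v.
Proof. by have /asboolP := away_valP x; apply. Qed.

Definition localize (x : away_ring oo) : val_ring v := ValRing (away_val_int x).

Fact localize_zmod : zmod_morphism localize.
Proof. by move=> x y; apply: val_inj; rewrite [RHS]rmorphB -[RHS]rmorphB. Qed.
Fact localize_monoid : monoid_morphism localize.
Proof.
split=> [|x y]; apply: val_inj; last first.
  by rewrite [RHS]rmorphM -[RHS]rmorphM.
by rewrite [RHS]rmorph1; exact: (rmorph1 (val : away_ring oo -> k)).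
Qed.
HB.instance Definition _ :=
  GRing.isZmodMorphism.Build (away_ring oo) (val_ring v) localize localize_zmod.
HB.instance Definition _ := GRing.isMonoidMorphism.Build
  (away_ring oo) (val_ring v) localize localize_monoid.

End Restrict.
End ValuationRing.

Section United.
Variables (k : fieldType) (oo : place k).
Local Notation O := (away_ring oo).
Variables (h a b c : O).
Hypothesis half : 2%:R * h = 1.
Hypothesis coprime_ab : exists r s, a * r + b * s = 1.

(** Over a local ring, a or the value a + 2b + ac at (1, 1) is a unit, as the
two are comaximal. *)
Lemma united_unit_value (R : comNzRingType) (f : {rmorphism O -> R}) :
  (forall x y r s : R, x * r + y * s = 1 ->
     (exists z, x * z = 1) \/ (exists z, y * z = 1)) ->
  exists x y m m', f a * x ^+ 2 + 2%:R * f b * (x * y) + f a * f c * y ^+ 2 = m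
    /\ m * m' = 1.
Proof.
move=> loc; have [r [s rs]] := coprime_ab.
have := loc (f a) (f a + 2%:R * f b + f a * f c)
  (f r - (1 + f c) * f h * f s) (f h * f s).
case=> [|[m' mm']|[m' mm']].
- have halff : 2%:R * f h = 1 by rewrite -(rmorph_nat f) -rmorphM half rmorph1.
  transitivity (f a * f r + f b * (2%:R * f h) * f s); first by ring.
  by rewrite halff mulr1 -!rmorphM -rmorphD rs rmorph1.
- by exists 1, 0, (f a), m'; split=> //; ring.
- exists 1, 1, (f a + 2%:R * f b + f a * f c), m'; split=> //; ring.
Qed.

Lemma field_comaximal (L : fieldType) (x y r s : L) :
  x * r + y * s = 1 -> (exists z, x * z = 1) \/ (exists z, y * z = 1).
Proof.
have [->|x0 _] := eqVneq x 0; last by left; exists x^-1; rewrite divff.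
by rewrite mul0r add0r; right; exists s.
Qed.

Lemma double_local_iso (R : comNzRingType) (f : {rmorphism O -> R}) :
  (forall x y r s : R, x * r + y * s = 1 ->
     (exists z, x * z = 1) \/ (exists z, y * z = 1)) ->
  iso_pts (bqf_map f (base_form a b c)) (bqf_map f (double_form a b c)) !=set0.
Proof.
move=> /(united_unit_value f)[x [y [m [m' [qxy mm']]]]].
rewrite base_form_map double_form_map; rewrite -qxy in mm'.
exact: double_local mm'.
Qed.

Lemma double_form_genus :
  iso_over_field (base_form a b c) (double_form a b c) /\
  forall v, v <> oo ->
    iso_over_completion v (base_form a b c) (double_form a b c).
Proof.
split; first exact: (double_local_iso val (@field_comaximal k)).
move=> v v_oo L w i [i_ext _ _].
have [M isoM] := double_local_iso (localize v_oo) (@val_ring_comaximal _ v).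
exists (map_mx (i \o val) M).
  apply/mxOverP => r s; rewrite mxE /=; have := val_ringP (M r s).
  by rewrite !inE fmorph_eq0 i_ext.
exact: iso_pts_map (i \o val) _ _ _ isoM.
Qed.

(** The ratio of the two torsor maps is a matrix over k.  Its universal property
identifies it with the ratio over the valuation ring of each v <> oo, so it
is integral away from oo. *)
Lemma torsor_sum_unique q3 q4 :
  torsor_sum (base_form a b c) (united_form a b c) (united_form a b c) q3 ->
  torsor_sum (base_form a b c) (united_form a b c) (united_form a b c) q4 ->
  iso_pts q3 q4 !=set0.
Proof.
move=> [phi3 phi3P] [phi4 phi4P].
have halff (R : comNzRingType) (f : {rmorphism O -> R}) : 2%:R * f h = 1.
  by rewrite -(rmorph_nat f) -rmorphM half rmorph1.
have [N isoN uniN] : exists2 N : 'M[k]_2,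
    iso_pts (bqf_map val q3) (bqf_map val q4) N &
    forall v, v <> oo -> N \is a mxOver (val_int v).
  have [x [y [m [m' [qxy mm']]]]] := united_unit_value val (@field_comaximal k).
  have [z] := united_quad_point qxy mm'.
  rewrite -base_form_map -united_form_map => hz.
  have [N isoN uniN] := ratio_descent phi3P phi4P (halff _ val) hz hz.
  exists N => // v v_oo.
  have [x' [y' [n [n' [qxy' nn']]]]] :=
    united_unit_value (localize v_oo) (@val_ring_comaximal _ v).
  have [z'] := united_quad_point qxy' nn'.
  rewrite -base_form_map -united_form_map => hz'.
  have [N' isoN' uniN'] := ratio_descent phi3P phi4P (halff _ (localize v_oo))
    hz' hz'.
  (* Both ratios are read off at the point z over k[t] / (t^2 - m). *)
  have NN' : N = map_mx val N'.
    apply/matrixP => r s; apply: (@quad_in_inj _ m).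
    have := uniN _ (quad_in m) (quad_in m \o val) z z (fun=> erefl) hz hz.
    rewrite (uniN' _ (quad_in m \o val) (quad_in m \o val) z z (fun=> erefl) hz
      hz).
    by move=> /matrixP/(_ r s); rewrite !mxE.
  by apply/mxOverP => r s; rewrite NN' mxE; apply: val_ringP.
have NO r s : N r s \in regular_away oo.
  by apply/asboolP => v v_oo; have /mxOverP := uniN v v_oo; apply.
pose M : 'M[O]_2 := \matrix_(r, s) AwayRing (NO r s).
exists M; apply: (@iso_pts_inj _ _ (val : O -> k)); first exact: val_inj.
suff -> : map_mx val M = N by [].
by apply/matrixP => r s; rewrite !mxE.
Qed.

End United.

(** * Polynomials in the ring of regular functions *)

Section Constants.
Variables (F : finFieldType) (k : fieldExtType {fraction {poly F}}).

Fact of_poly_zmod : zmod_morphism (of_poly k).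
Proof. by move=> x y; rewrite /of_poly rmorphB scalerBl. Qed.
Fact of_poly_monoid : monoid_morphism (of_poly k).
Proof.
split=> [|x y]; first by rewrite /of_poly rmorph1 scale1r.
by rewrite /of_poly rmorphM -scalerAl mul1r scalerA.
Qed.
HB.instance Definition _ :=
  GRing.isZmodMorphism.Build {poly F} k (of_poly k) of_poly_zmod.
HB.instance Definition _ :=
  GRing.isMonoidMorphism.Build {poly F} k (of_poly k) of_poly_monoid.

Lemma of_poly_eq0 c : (of_poly k c == 0) = (c == 0).
Proof. by rewrite /of_poly scaler_eq0 oner_eq0 orbF tofrac_eq0. Qed.

(** Nonzero constants have finite order, as c ^ #|F| = c. *)
Lemma place_const (v : place k) (c : F) : c != 0 -> v (const_in k c) = 0.
Proof.
rewrite /const_in => c0; set x := of_poly k _.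
have x0 : x != 0 by rewrite of_poly_eq0 polyC_eq0.
have xX : x ^+ #|F| = x by rewrite /x -rmorphXn -polyC_exp expf_card.
have := placeX v #|F| x0; rewrite xX => /eqP.
have := finNzRing_gt1 F; case: #|F| => [|[|n]] // _.
rewrite mulrSr -subr_eq0 opprD addrCA subrr addr0 oppr_eq0 mulrn_eq0 /=.
by move/eqP.
Qed.

Variable ook : place k.
Hypothesis k_imag : forall v : place k, over_infty v -> v = ook.

(** The poles of x lie over 1/x, and oo is the only such place. *)
Lemma of_poly_regular (c : {poly F}) : of_poly k c \in regular_away ook.
Proof.
elim/poly_ind: c => [|c a IHc]; first by rewrite rmorph0 rpred0.
rewrite rmorphD rmorphM rpredD ?rpredM //; apply/asboolP => v v_ook;
  rewrite !inE.
  rewrite leNgt; apply/orP; right; apply/negP => vX.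
  have X0 : of_poly k 'X != 0 by rewrite of_poly_eq0 polyX_eq0.
  by apply/v_ook/k_imag; rewrite /over_infty placeV // oppr_gt0.
have [->|a0] := eqVneq a 0; first by rewrite polyC0 rmorph0 eqxx.
by rewrite -/(const_in k a) place_const // lexx orbT.
Qed.

Definition poly_in_away (c : {poly F}) : away_ring ook :=
  AwayRing (of_poly_regular c).

Fact poly_in_away_zmod : zmod_morphism poly_in_away.
Proof.
move=> x y; apply: val_inj; rewrite [RHS]rmorphB.
exact: (rmorphB (of_poly k)).
Qed.
Fact poly_in_away_monoid : monoid_morphism poly_in_away.
Proof.
split=> [|x y]; apply: val_inj.
  by rewrite [RHS]rmorph1; exact: (rmorph1 (of_poly k)).
by rewrite [RHS]rmorphM; exact: (rmorphM (of_poly k)).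
Qed.
HB.instance Definition _ := GRing.isZmodMorphism.Build
  {poly F} (away_ring ook) poly_in_away poly_in_away_zmod.
HB.instance Definition _ := GRing.isMonoidMorphism.Build
  {poly F} (away_ring ook) poly_in_away poly_in_away_monoid.

Lemma away_pi_regular (b x : away_ring ook) : b != 0 -> pi_regular b x.
Proof.
have val0 (z : away_ring ook) : (val z == 0) = (z == 0).
  by rewrite -(rmorph0 (val : away_ring ook -> k)) (inj_eq val_inj).
apply: (@pi_regularW F _ poly_in_away).
- move=> y z yz0 y0; apply/eqP; rewrite -val0.
  have /eqP := congr1 val yz0; rewrite rmorphM rmorph0 mulf_eq0 !val0.
  by rewrite (negbTE y0).
- move=> y z /(congr1 val) eq_yz; apply/eqP; rewrite -subr_eq0 -of_poly_eq0.
  by rewrite rmorphB; apply/eqP; apply/(canLR (addrK _)); rewrite add0r.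
- move=> y; have [P P0 Py] := fieldext_annihilator (val y).
  exists P => //; apply: val_inj; rewrite rmorph0 -Py -horner_map
    -map_poly_comp.
  by congr (_.[_]).
Qed.

End Constants.

(** * The square of a class lies in the principal genus *)

Theorem corollary5p3
  (F : finFieldType) (p : nat) (p_char : p \in [pchar F]) (p_odd : odd p)
  (k : fieldExtType {fraction {poly F}})
  (k_geom : full_constant_field (const_in k))
  (ook : place k) (ook_over : over_infty ook)
  (k_imag : forall v : place k, over_infty v -> v = ook)
  (K : fieldExtType k) (K_quad : \dim {:K} = 2%N)
  (K_geom : full_constant_field (fun c : F => (const_in k c)%:A : K))
  (ooK : place K) (ooK_over : lies_over (in_alg K) ooK ook)
  (K_imag : forall w : place K, lies_over (in_alg K) w ook -> w = ooK)
  (alpha : away_ring ook) (s : K) (s_sqr : s ^+ 2 = (val alpha)%:A)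
  (OK_sum : forall z : K, z \in regular_away ooK <->
     exists a b : away_ring ook, z = (val a)%:A + s * (val b)%:A)
  (OK_direct : forall a b : away_ring ook,
     (val a)%:A + s * (val b)%:A = 0 -> a = 0 /\ b = 0)
  (q : bqf (away_ring ook)) (q_norm : q = Bqf 1 0 (- alpha))
  (q' : bqf (away_ring ook)) (q'_cl0 : cl0 (disc q) (sl2_class q')) :
  Cl_infty q (star q (sl2_class q') (sl2_class q')).
Proof.
have two0 : 2%:R != 0 :> F.
  have /andP[p_prime /eqP p0] := p_char.
  by rewrite -(dvdn_pcharf p_char); case: (p) p_odd p_prime {p0} => [|[|[|n]]]
    // _ _;
    rewrite gtnNdvd.
pose h := poly_in_away k_imag (2%:R^-1)%:P.
have half : 2%:R * h = 1.
  by rewrite /h -(rmorph_nat (poly_in_away k_imag)) -rmorphM -polyC_natr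
    -polyCM divff ?rmorph1.
(* Otherwise s = 0, and 0 + s * 1 = 0 contradicts directness. *)
have alpha0 : alpha != 0.
  apply/eqP => alpha0; have /eqP := s_sqr.
  rewrite alpha0 rmorph0 scale0r sqrf_eq0 => /eqP s0.
  have [|_ /eqP] := OK_direct 0 1; last by rewrite oner_eq0.
  by rewrite s0 mul0r addr0 rmorph0 scale0r.
have [q0 [q0_prim q0_disc q'E]] := q'_cl0.
rewrite {}q'E q_norm in q0_disc *.
have [a [b [c [q0_united baseE coprime_ab]]]] := united_representative half
  (fun x => away_pi_regular k_imag x alpha0) q0_prim q0_disc.
rewrite -baseE.
set qN := united_form a b c in q0_united; set q2 := double_form a b c.
have q2_disc : disc q2 = disc (base_form a b c).
  by rewrite !disc2 /=; ring.
(* (a r + b t)^2 = 1 is a combination of a^2 and 2b. *)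
have q2_prim : primitive q2.
  have [r [t rt]] := coprime_ab.
  apply: (@coef_primitive _ _ _ _ (r ^+ 2) (h * t * (2%:R * a * r + b * t)) 0).
  transitivity ((a * r + b * t) ^+ 2); last by rewrite rt expr1n.
  transitivity (a ^+ 2 * r ^+ 2 + (2%:R * h) * (b * t) * (2%:R * a * r + b *
    t)).
    by ring.
  by rewrite half; ring.
have starE : star (base_form a b c) (sl2_class q0) (sl2_class q0) = sl2_class
  q2.
  apply/seteqP; split=> q3 /=.
    move=> [q3_prim q3_disc [q1 [q1' [q01 q01' sum3]]]].
    apply: (torsor_sum_unique half coprime_ab (double_torsor_sum a b c half)).
    apply: torsor_sum_iso sum3; last exact: iso_refl.
      by apply: iso_trans q01; apply: iso_sym.
    by apply: iso_trans q01'; apply: iso_sym.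
  move=> iso23; split; first exact: iso_primitive q2_prim.
    by rewrite -(iso_disc iso23).
  exists qN, qN; split; [exact: q0_united | exact: q0_united | ].
  have sum2 := double_torsor_sum a b c half.
  exact: (torsor_sum_iso (iso_refl qN) (iso_refl qN) iso23 sum2).
have [q2_field q2_comp] := double_form_genus c half coprime_ab.
exists q2; split=> //.
by rewrite starE; exists q2.
Qed.
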